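(* Let $m\in\mathbb{N}$ with $m\ge 2$. Let $X_1,\dots,X_m,Y$ be independent with $X_i\sim\mathrm{Po}(\lambda_i)$ for $i=1,\dots,m$ and $Y\sim \mathrm{Po}\big(\sum_{i=1}^m\lambda_i\big)$, where $\lambda=(\lambda_1,\dots,\lambda_m)\in(0,\infty)^m$ is unknown, and consider estimation of $\lambda$ on the basis of $(X,Y)$, $X=(X_1,\dots,X_m)$, under the loss $L(d,\lambda)=\sum_{i=1}^m (d_i-\lambda_i)^2/\lambda_i$. Put $X_\cdot=\sum_{i=1}^m X_i$ and $$\hat\lambda^{\mathrm{ML}}(X,Y)=\frac{X_\cdot+Y}{2}\,\frac{X}{X_\cdot},\qquad \hat\lambda^{\mathrm{O}}(X,Y)=\frac{X_\cdot+Y+m-1}{2}\,\frac{X}{X_\cdot+m-1},\qquad \hat\lambda(X,Y)=\frac{X_\cdot+Y}{2}\,\frac{X}{X_\cdot+m-1}.$$ Then: (i) $\hat\lambda^{\mathrm{ML}}(X,Y)$ is dominated by $\hat\lambda^{\mathrm{O}}(X,Y)$; (ii) $\hat\lambda^{\mathrm{O}}(X,Y)$ is dominated by $\hat\lambda(X,Y)$.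
   Context: $\mathrm{Po}(\mu)$ is the Poisson distribution with mean $\mu$. The risk of an estimator $\delta$ at $\lambda$ is $E_\lambda[L(\delta(X,Y),\lambda)]$. An estimator $\delta$ is dominated by $\delta'$ if the risk of $\delta'$ is at most the risk of $\delta$ for every $\lambda\in(0,\infty)^m$, with strict inequality for at least one $\lambda$. Convention: $\hat\lambda^{\mathrm{ML}}(X,Y)$ is the zero vector when $X=(0,\dots,0)$ (i.e. $0/0$ is read as $0$). *)

(* Defs.v *)
From HB Require Import structures.
From mathcomp Require Import all_boot all_order all_algebra.
From mathcomp Require Import all_classical all_reals all_analysis.

Set Implicit Arguments.
Unset Strict Implicit.
Unset Printing Implicit Defensive.

Import Order.TTheory GRing.Theory Num.Theory.

Local Open Scope classical_set_scope.
Local Open Scope ring_scope.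

Definition mutually_independent (R : realType) (d d' : measure_display)
    (T : measurableType d) (T' : measurableType d') (P : probability T R)
    (I : finType) (Z : I -> {mfun T >-> T'}) : Prop :=
  forall (J : {set I}) (B : I -> set T'), (forall i, measurable (B i)) ->
    P (\bigcap_(i in [set` J]) (Z i @^-1` B i)) =
    (\prod_(i in J) P (Z i @^-1` B i))%E.

(* The natural number argument of [poisson_prob] is a dummy: its value is
   irrelevant. *)
Definition has_poisson_law (R : realType) (d : measure_display)
    (T : measurableType d) (P : probability T R)
    (Z : {mfun T >-> nat}) (mu : R) : Prop :=
  forall A : set nat, distribution P Z A = poisson_prob mu 0 A.

Definition positive_row (R : realType) (m : nat) (lam : 'rV[R]_m) : Prop :=
  forall i, 0 < lam 0 i.

(* The family (X_1, ..., X_m, Y) is indexed by [option 'I_m]; [None] is Y. *)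
Definition joint_family (d : measure_display) (T : measurableType d) (m : nat)
    (X : 'I_m -> {mfun T >-> nat}) (Y : {mfun T >-> nat})
    (o : option 'I_m) : {mfun T >-> nat} :=
  if o is Some i then X i else Y.

Definition poisson_model (R : realType) (d : measure_display)
    (T : measurableType d) (m : nat) (P : 'rV[R]_m -> probability T R)
    (X : 'I_m -> {mfun T >-> nat}) (Y : {mfun T >-> nat}) : Prop :=
  forall lam : 'rV[R]_m, positive_row lam ->
    [/\ mutually_independent (P lam) (joint_family X Y),
        forall i, has_poisson_law (P lam) (X i) (lam 0 i)
      & has_poisson_law (P lam) Y (\sum_i lam 0 i)].

Definition estimator (R : realType) (m : nat) : Type :=
  'rV[nat]_m -> nat -> 'rV[R]_m.

Definition loss (R : realType) (m : nat) (dec lam : 'rV[R]_m) : R :=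
  \sum_i (dec 0 i - lam 0 i) ^+ 2 / lam 0 i.

Definition risk (R : realType) (d : measure_display) (T : measurableType d)
    (m : nat) (P : 'rV[R]_m -> probability T R)
    (X : 'I_m -> {mfun T >-> nat}) (Y : {mfun T >-> nat})
    (delta : estimator R m) (lam : 'rV[R]_m) : \bar R :=
  ('E_(P lam)[fun t => loss (delta (\row_i X i t) (Y t)) lam])%E.

Definition risk_dominated_by (R : realType) (d : measure_display)
    (T : measurableType d) (m : nat) (P : 'rV[R]_m -> probability T R)
    (X : 'I_m -> {mfun T >-> nat}) (Y : {mfun T >-> nat})
    (delta delta' : estimator R m) : Prop :=
  (forall lam, positive_row lam ->
     (risk P X Y delta' lam <= risk P X Y delta lam)%E) /\
  (exists2 lam, positive_row lam &
     (risk P X Y delta' lam < risk P X Y delta lam)%E).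

Definition row_total (R : realType) (m : nat) (x : 'rV[nat]_m) : R :=
  \sum_i (x 0 i)%:R.

(* As division by zero yields zero, the value at x = 0 is the zero vector. *)
Definition lam_ML (R : realType) (m : nat) : estimator R m := fun x y =>
  ((row_total R x + y%:R) / 2) *: \row_i ((x 0 i)%:R / row_total R x).

Definition lam_O (R : realType) (m : nat) : estimator R m := fun x y =>
  ((row_total R x + y%:R + m%:R - 1) / 2) *:
    \row_i ((x 0 i)%:R / (row_total R x + m%:R - 1)).

Definition lam_hat (R : realType) (m : nat) : estimator R m := fun x y =>
  ((row_total R x + y%:R) / 2) *: \row_i ((x 0 i)%:R / (row_total R x + m%:R - 1)).

(* Main.v *)
Require Import Defs.
From HB Require Import structures.
From mathcomp Require Import all_boot all_order all_algebra.
From mathcomp Require Import all_classical all_reals all_analysis.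
From mathcomp Require Import measurable_realfun ring lra zify.

(* Poisson variables satisfy E[W_i F(W)] = mu_i E[F(W + e_i)].  For an estimator
   of the form g(X_., Y) X this turns the risk into
     E[(X_. + m) g(X_. + 1, Y)^2] - 2 L E[g(X_. + 1, Y)] + L,
   where L is the sum of the lambda_i; in particular g(0, _) plays no role.  In
   the difference of the risks of two of the estimators, the factors Y and L are
   then removed by further applications of the same identity (to Y and to X_.),
   until the difference becomes the expectation of an explicit function of X_.
   that is positive everywhere: all the dominations are strict at every lambda. *)

Set Implicit Arguments.
Unset Strict Implicit.
Unset Printing Implicit Defensive.

Import Order.TTheory GRing.Theory Num.Theory.

Local Open Scope classical_set_scope.
Local Open Scope ring_scope.

(** * Integration of functions of a countable-valued map *)

Section countable_valued.
Context d (T : measurableType d) (R : realType) (K : countType).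
Variables (W : T -> K) (mW : forall k, measurable (W @^-1` [set k])).

Lemma measurable_preimage_countable (A : set K) : measurable (W @^-1` A).
Proof.
have -> : W @^-1` A = \bigcup_(k in A) (W @^-1` [set k]).
  by apply/seteqP; split => [t /= At|t /= [k Ak /= ->]//]; exists (W t).
rewrite bigcup_mkcond.
apply: countable_bigcupT_measurable => [|k]; first exact: countableP.
by case: ifP.
Qed.

Lemma measurable_fun_countable d' (U : sigmaRingType d') D (F : K -> U) :
  measurable_fun D (F \o W).
Proof.
move=> mD B _; apply: measurableI => //; rewrite comp_preimage.
exact: measurable_preimage_countable.
Qed.

(** The space splits into the countably many fibres of [W], and the integrand is constant on
    each. *)
Lemma ge0_integral_countable (mu : {measure set T -> \bar R})
    (F : K -> \bar R) : (forall k, 0 <= F k)%E ->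
  (\int[mu]_t F (W t) = \esum_(k in setT) (F k * mu (W @^-1` [set k])))%E.
Proof.
(* Each [S n] is empty or a singleton because [pickle] is injective; this indexes the fibres by
   natural numbers, as countable additivity of the integral requires. *)
move=> F0; pose S n : set K := [set k | pickle k = n].
have SU : \bigcup_n S n = setT by apply/seteqP; split => // k _; exists (pickle k).
have tS : trivIset setT S by move=> i j _ _ [k [<- <-]].
rewrite -SU nneseries_sum_bigcup//; last by move=> k; rewrite mule_ge0.
have <- : \bigcup_n (W @^-1` S n) = setT by rewrite -preimage_bigcup SU.
rewrite ge0_integral_bigcup//; last 3 first.
- by move=> n; exact: measurable_preimage_countable.
- exact: (measurable_fun_countable F).
- by move=> i j _ _ [t [<- <-]].
apply: eq_eseriesr => n _.
have [[k kn]|nk] := pselect (exists k : K, pickle k = n).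
  have -> : S n = [set k].
    apply/seteqP; split => [l /= ln|l /= ->//].
    by apply: (pcan_inj pickleK); rewrite ln kn.
  rewrite esum_set1 ?mule_ge0// -integral_cst//.
  by apply: eq_integral => t /set_mem /= ->.
have -> : S n = set0 by rewrite -subset0 => k kn; apply: nk; exists k.
by rewrite preimage_set0 integral_set0 esum_set0.
Qed.

End countable_valued.

(** * The shift identity for independent Poisson variables, nonnegative case *)

Definition incr (I : finType) (i : I) (w : {ffun I -> nat}) : {ffun I -> nat} :=
  [ffun j => (w j + (j == i))%N].

Definition tuple_of (T : Type) (I : finType) (Z : I -> T -> nat) (t : T)
  : {ffun I -> nat} := [ffun i => Z i t].

Lemma poisson_pmfS (R : realType) (mu : R) k : 0 < mu ->
  k.+1%:R * poisson_pmf mu k.+1 = mu * poisson_pmf mu k.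
Proof.
move=> mu0; rewrite /poisson_pmf mu0 exprS factS natrM.
by field; rewrite pnatr_eq0 -lt0n fact_gt0 nat1r pnatr_eq0.
Qed.

Section independent_poisson.
Context (R : realType) d (T : measurableType d) (P : probability T R).
Context (I : finType) (Z : I -> {mfun T >-> nat}) (mu : I -> R).
Hypothesis mu0 : forall i, 0 < mu i.
Hypothesis indZ : mutually_independent P Z.
Hypothesis lawZ : forall i, has_poisson_law P (Z i) (mu i).
Local Notation W := (tuple_of Z).

Lemma preimage_tuple_of w :
  W @^-1` [set w] = \bigcap_(i in [set` [set: I]%SET]) (Z i @^-1` [set w i]).
Proof.
apply/seteqP; split => [t /= <- i _|t /= h]; first by rewrite /tuple_of ffunE.
by apply/ffunP => i; rewrite ffunE; apply: h; rewrite /= inE.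
Qed.

Lemma measurable_tuple_of w : measurable (W @^-1` [set w]).
Proof.
rewrite preimage_tuple_of; apply: fin_bigcap_measurable => // i _.
by rewrite -[X in measurable X]setTI; exact: measurable_funPT.
Qed.

Lemma tuple_of_pmf w :
  P (W @^-1` [set w]) = (\prod_i poisson_pmf (mu i) (w i))%:E.
Proof.
rewrite preimage_tuple_of indZ// [LHS](eq_bigl xpredT); last by move=> i; rewrite inE.
rewrite -prodEFin; apply: eq_bigr => i _.
have := lawZ i [set w i]; rewrite /distribution /pushforward => ->.
by rewrite /poisson_prob mu0 esum_set1// lee_fin poisson_pmf_ge0.
Qed.

(** Both sides become sums over sample values. On the left the terms with [w i = 0] vanish, the
    others are reindexed by [incr i], and [poisson_pmfS] trades the factor [(w i).+1] for [mu i].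
    For nonnegative [F] this holds in the extended reals without integrability, so it can serve to
    prove that moments are finite. *)
Lemma ge0_poisson_shift i (F : {ffun I -> nat} -> R) : (forall w, 0 <= F w) ->
  (\int[P]_t ((W t i)%:R * F (W t))%:E =
   \int[P]_t (mu i * F (incr i (W t)))%:E)%E.
Proof.
move=> F0.
pose G (w : {ffun I -> nat}) := ((w i)%:R * F w)%:E.
pose H (w : {ffun I -> nat}) := (mu i * F (incr i w))%:E.
rewrite (ge0_integral_countable measurable_tuple_of P (F := G)); last first.
  by move=> w; rewrite lee_fin mulr_ge0.
rewrite (ge0_integral_countable measurable_tuple_of P (F := H)); last first.
  by move=> w; rewrite lee_fin mulr_ge0// ltW.
pose A := [set w : {ffun I -> nat} | (0 < w i)%N].
rewrite [LHS](_ : _ = \esum_(w in A) (G w * P (W @^-1` [set w])))%E; last first.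
  rewrite [RHS]esum_mkcond; apply: eq_esum => w _.
  case: ifPn => //; rewrite notin_setE /A /= => /negP; rewrite -eqn0Ngt => /eqP w0.
  by rewrite /G w0 mul0r mul0e.
rewrite (reindex_esum setT A (incr i)); last first.
  split.
  - by move=> w _; rewrite /A /= /incr ffunE eqxx addn1.
  - move=> w v _ _ /ffunP h; apply/ffunP => j.
    by have := h j; rewrite !ffunE => /addIn.
  - move=> w /= wi; exists [ffun j => (w j - (j == i))%N] => //.
    apply/ffunP => j; rewrite !ffunE.
    by case: eqP => [->|_]; [rewrite subnK|rewrite subn0 addn0].
apply: eq_esum => w _.
rewrite [X in (_ * X = _)%E]tuple_of_pmf [X in (_ = _ * X)%E]tuple_of_pmf.
rewrite /G /H -!EFinM; congr EFin.
(* The two product masses differ only in the factor at [i]. *)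
rewrite (bigD1 i)//= [in RHS](bigD1 i)//= ffunE eqxx addn1.
rewrite (eq_bigr (fun j => poisson_pmf (mu j) (w j))); last first.
  by move=> j /negPf ji; rewrite ffunE ji addn0.
set p := \prod_(_ | _) _.
transitivity (F (incr i w) * p * ((w i).+1%:R * poisson_pmf (mu i) (w i).+1)).
  by ring.
by rewrite poisson_pmfS//; ring.
Qed.

End independent_poisson.

(** * Functions of polynomial growth *)

Definition weight (I : finType) (w : {ffun I -> nat}) : nat := (\sum_i w i)%N.

Lemma weight_incr (I : finType) (i : I) w : weight (incr i w) = (weight w).+1.
Proof.
rewrite /weight (eq_bigr (fun j => w j + (j == i))%N); last by move=> j _; rewrite ffunE.
by rewrite big_split/= -big_mkcond/= big_pred1_eq addn1.
Qed.

Section polynomially_bounded.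
Context (R : realType) (I : finType).
Implicit Types F G : {ffun I -> nat} -> R.

(** A class closed under ring operations and shifts whose members are all integrable in the Poisson
    model, so that integrability becomes a structural check. The base is at least 1, hence its
    powers increase with the exponent. *)
Definition polybd F :=
  exists2 C, 0 <= C & exists k, forall w, `|F w| <= C * (weight w).+1%:R ^+ k.

Lemma bounded_polybd (C : R) F : (forall w, `|F w| <= C) -> polybd F.
Proof.
move=> FC; exists C; first exact: le_trans (normr_ge0 _) (FC [ffun=> 0%N]).
by exists 0%N => w; rewrite expr0 mulr1.
Qed.

Lemma polybd_cst (c : R) : polybd (fun=> c).
Proof. exact: (@bounded_polybd `|c|). Qed.

(** The bound 1 also covers [f w = 0], where the inverse is 0 by convention. *)
Lemma polybd_inv (f : {ffun I -> nat} -> nat) : polybd (fun w => (f w)%:R^-1).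
Proof.
apply: (@bounded_polybd 1) => w; rewrite ger0_norm ?invr_ge0//.
by case: (f w) => [|n]; rewrite ?invr0// invf_le1 ?ler1n ?ltr0n.
Qed.

Lemma polybd_coord i : polybd (fun w => (w i)%:R).
Proof.
exists 1 => //; exists 1%N => w; rewrite mul1r expr1 ger0_norm// ler_nat.
by rewrite ltnW// ltnS /weight (bigD1 i)//= leq_addr.
Qed.

Lemma polybdD F G : polybd F -> polybd G -> polybd (fun w => F w + G w).
Proof.
move=> [C C0 [k Fk]] [D D0 [l Gl]]; exists (C + D); first exact: addr_ge0.
have le1 (w : {ffun I -> nat}) p q :
    (weight w).+1%:R ^+ p <= (weight w).+1%:R ^+ (p + q) :> R.
  by apply: ler_weXn2l; rewrite ?ler1n ?leq_addr.
exists (k + l)%N => w; rewrite (le_trans (ler_normD _ _))// mulrDl lerD//.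
  by rewrite (le_trans (Fk w))// ler_wpM2l.
by rewrite (le_trans (Gl w))// ler_wpM2l// addnC.
Qed.

Lemma polybdM F G : polybd F -> polybd G -> polybd (fun w => F w * G w).
Proof.
move=> [C C0 [k Fk]] [D D0 [l Gl]]; exists (C * D); first exact: mulr_ge0.
by exists (k + l)%N => w; rewrite normrM exprD mulrACA ler_pM.
Qed.

Lemma polybdN F : polybd F -> polybd (fun w => - F w).
Proof.
by move=> [C C0 [k Fk]]; exists C => //; exists k => w; rewrite normrN.
Qed.

Lemma polybdX F n : polybd F -> polybd (fun w => F w ^+ n).
Proof.
move=> bF; elim: n => [|n IH]; first exact: polybd_cst.
under eq_fun do rewrite exprS; exact: polybdM.
Qed.

Lemma polybd_sum (J : Type) (r : seq J) (F : J -> {ffun I -> nat} -> R) :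
  (forall j, polybd (F j)) -> polybd (fun w => \sum_(j <- r) F j w).
Proof.
move=> bF; elim: r => [|j r IH].
  by under eq_fun do rewrite big_nil; exact: polybd_cst.
by under eq_fun do rewrite big_cons; exact: polybdD.
Qed.

Lemma polybd_incr i F : polybd F -> polybd (fun w => F (incr i w)).
Proof.
(* The shift turns the base N + 1 into N + 2, which is at most 2 (N + 1). *)
move=> [C C0 [k Fk]]; exists (C * 2 ^+ k); first by rewrite mulr_ge0// exprn_ge0.
exists k => w; rewrite (le_trans (Fk _))// -mulrA ler_wpM2l// -exprMn -natrM.
by rewrite lerXn2r ?nnegrE// ler_nat weight_incr; lia.
Qed.

End polynomially_bounded.

(** * Real-valued expectations under the Poisson model *)

Definition mean (R : realType) d (T : measurableType d) (P : probability T R)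
    (I : finType) (Z : I -> {mfun T >-> nat}) (F : {ffun I -> nat} -> R) : R :=
  Rintegral P setT (fun t => F (tuple_of Z t)).

Section poisson_expectation.
Context (R : realType) d (T : measurableType d) (P : probability T R).
Context (I : finType) (Z : I -> {mfun T >-> nat}) (mu : I -> R).
Hypothesis mu0 : forall i, 0 < mu i.
Hypothesis indZ : mutually_independent P Z.
Hypothesis lawZ : forall i, has_poisson_law P (Z i) (mu i).
Local Notation W := (tuple_of Z).
Local Notation mean := (mean P Z).
Implicit Types F G : {ffun I -> nat} -> R.

Let mW F : measurable_fun setT (fun t => (F (W t))%:E).
Proof.
exact: (measurable_fun_countable (measurable_tuple_of Z) (EFin \o F)).
Qed.

Let moment_step k (w : {ffun I -> nat}) :
  (weight w).+1%:R ^+ k.+1 =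
  (weight w).+1%:R ^+ k + \sum_i (w i)%:R * (weight w).+1%:R ^+ k :> R.
Proof.
by rewrite -mulr_suml -natr_sum exprS -/(weight w) -natr1; ring.
Qed.

(** Induction on [k]: one factor is expanded as 1 plus the sum of the [w i], the shift identity
    replaces each [w i] by [mu i] and a shift, and the shifted power is at most [2 ^+ k] times the
    original one. *)
Lemma integrable_moment k :
  P.-integrable setT (fun t => ((weight (W t)).+1%:R ^+ k)%:E).
Proof.
elim: k => [|k IH].
  by under eq_fun do rewrite expr0; exact: finite_measure_integrable_cst.
under eq_fun do rewrite moment_step EFinD.
apply: integrableD => //.
under eq_fun do rewrite -sumEFin.
apply: integrable_sum => // i _; apply/integrableP; split.
  exact: (@mW (fun w => (w i)%:R * (weight w).+1%:R ^+ k)).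
under eq_integral => t _ do rewrite gee0_abs ?lee_fin ?mulr_ge0 ?exprn_ge0//.
rewrite (ge0_poisson_shift mu0 indZ lawZ i (F := fun w => (weight w).+1%:R ^+ k));
  last first.
  by move=> w; rewrite exprn_ge0.
have /integrableP[_] := integrableZl measurableT (mu i * 2 ^+ k) IH.
apply: le_lt_trans; apply: ge0_le_integral => //.
- by move=> t _; rewrite lee_fin mulr_ge0 ?exprn_ge0// ltW.
- exact: (@mW (fun w => mu i * (weight (incr i w)).+1%:R ^+ k)).
- apply: measurableT_comp => //.
  exact: (@mW (fun w => mu i * 2 ^+ k * (weight w).+1%:R ^+ k)).
move=> t _; rewrite -EFinM gee0_abs lee_fin ?mulr_ge0 ?exprn_ge0 ?(ltW (mu0 i))//.
rewrite -mulrA ler_wpM2l ?(ltW (mu0 i))// -exprMn -natrM.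
by rewrite lerXn2r ?nnegrE// ler_nat weight_incr; lia.
Qed.

Lemma polybd_integrable F : polybd F -> P.-integrable setT (fun t => (F (W t))%:E).
Proof.
move=> [C C0 [k Fk]].
have intC := integrableZl measurableT C (integrable_moment k).
apply: (le_integrable measurableT (mW F) _ intC).
move=> t _; rewrite -EFinM lee_fin/= (le_trans (Fk _))//.
by rewrite ler_norm.
Qed.

(** The passage from the extended-real risk to real numbers, where ring and linear arithmetic
    apply. *)
Lemma expectation_mean F : polybd F -> ('E_P[fun t => F (W t)] = (mean F)%:E)%E.
Proof.
move=> bF; rewrite unlock /mean /Rintegral fineK//.
by apply: integrable_fin_num => //; exact: polybd_integrable.
Qed.

Lemma meanD F G : polybd F -> polybd G -> mean (fun w => F w + G w) = mean F + mean G.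
Proof. by move=> bF bG; rewrite /mean RintegralD//; exact: polybd_integrable. Qed.

Lemma meanZ (c : R) F : polybd F -> mean (fun w => c * F w) = c * mean F.
Proof. by move=> bF; rewrite /mean RintegralZl//; exact: polybd_integrable. Qed.

Lemma mean_sum (J : Type) (r : seq J) (F : J -> {ffun I -> nat} -> R) :
  (forall j, polybd (F j)) ->
  mean (fun w => \sum_(j <- r) F j w) = \sum_(j <- r) mean (F j).
Proof.
move=> bF; elim: r => [|j r IH].
  rewrite big_nil /mean; under eq_Rintegral do rewrite big_nil.
  by rewrite Rintegral_cst// mul0r.
rewrite big_cons -IH -(meanD (bF j) (polybd_sum r bF)).
by rewrite /mean; under eq_Rintegral do rewrite big_cons.
Qed.

(** A nonnegative integrand with zero integral vanishes almost everywhere; as [F] vanishes nowhere,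
    the whole space would be a null set, against total mass 1. *)
Lemma mean_gt0 F : polybd F -> (forall w, 0 < F w) -> 0 < mean F.
Proof.
move=> bF F0.
have i0 : (0 <= \int[P]_t (F (W t))%:E)%E.
  by apply: integral_ge0 => t _; rewrite lee_fin ltW.
rewrite lt_neqAle [X in _ && X]Rintegral_ge0 ?andbT; last by move=> t _; exact: ltW.
apply/eqP => e0.
have : (\int[P]_t `|(F (W t))%:E| = 0)%E.
  under eq_integral => t _ do rewrite gee0_abs ?lee_fin ?(ltW (F0 _))//.
  rewrite -[LHS]fineK; last by apply: integrable_fin_num => //; exact: polybd_integrable.
  by rewrite [fine _](_ : _ = 0).
move/(ae_eq_integral_abs P measurableT (mW F)) => [A [mA PA sA]].
have := probability_setT P; rewrite (_ : setT = A); last first.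
  apply/esym; rewrite -subTset => t _; apply: sA => /= /(_ Logic.I).
  by move=> [] Ft0; have := F0 (W t); rewrite Ft0 ltxx.
by rewrite PA => /eqP; rewrite eq_sym onee_eq0.
Qed.

Lemma mean_shift i F : polybd F ->
  mean (fun w => (w i)%:R * F w) = mu i * mean (fun w => F (incr i w)).
Proof.
move=> bF; rewrite -meanZ; last exact: polybd_incr.
have shift_ge0 G : polybd G -> (forall w, 0 <= G w) ->
    mean (fun w => (w i)%:R * G w) = mean (fun w => mu i * G (incr i w)).
  by move=> bG G0; rewrite /mean /Rintegral (ge0_poisson_shift mu0 indZ lawZ).
have [C C0 [k Fk]] := bF.
(* Adding the dominating polynomial B reduces to nonnegative functions. *)
pose B (w : {ffun I -> nat}) := C * (weight w).+1%:R ^+ k : R.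
have B0 w : 0 <= B w by rewrite mulr_ge0// exprn_ge0.
have bB : polybd B by exists C => //; exists k => w; rewrite ger0_norm.
have FB0 w : 0 <= F w + B w.
  by rewrite -lerBlDr sub0r; have := Fk w; rewrite ler_norml => /andP[].
have := shift_ge0 _ (polybdD bF bB) FB0.
under [X in mean X = _]eq_fun do rewrite mulrDr.
under [X in _ = mean X]eq_fun do rewrite mulrDr.
rewrite !meanD; try by apply: polybdM; [exact: polybd_coord|].
- by rewrite (shift_ge0 B bB B0) => /addIr.
- by apply: polybdM; [exact: polybd_cst|exact: polybd_incr].
- by apply: polybdM; [exact: polybd_cst|exact: (polybd_incr i bB)].
Qed.

End poisson_expectation.

(** * Statistics depending on the sample through X_. and Y only *)

Definition sumX (m : nat) (w : {ffun option 'I_m -> nat}) : nat :=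
  (\sum_i w (Some i))%N.

(* The statistic G(X_., Y) as a function of the whole sample. *)
Definition marginal (R : realType) (m : nat) (G : nat -> nat -> R)
  (w : {ffun option 'I_m -> nat}) : R := G (sumX w) (w None).

Lemma sumX_incr m (i : 'I_m) w : sumX (incr (Some i) w) = (sumX w).+1.
Proof.
rewrite /sumX (eq_bigr (fun j => w (Some j) + (j == i))%N).
  by rewrite big_split/= -big_mkcond/= big_pred1_eq addn1.
by move=> j _; rewrite ffunE.
Qed.

Lemma sumX_incr_None m (w : {ffun option 'I_m -> nat}) :
  sumX (incr None w) = sumX w.
Proof. by apply: eq_bigr => j _; rewrite ffunE addn0. Qed.

Section marginal_polybd.
Context (R : realType) (m : nat).
Local Notation bd G := (polybd (@marginal R m G)).
Implicit Types F G : nat -> nat -> R.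

Lemma polybdm_cst (c : R) : bd (fun _ _ => c).
Proof. exact: polybd_cst. Qed.

Lemma polybdm_z : bd (fun z _ => z%:R).
Proof.
rewrite /marginal /sumX; under eq_fun do rewrite natr_sum.
by apply: polybd_sum => i; exact: polybd_coord.
Qed.

Lemma polybdm_y : bd (fun _ y => y%:R).
Proof. exact: polybd_coord. Qed.

Lemma polybdm_zD k : bd (fun z _ => (z + k)%:R).
Proof.
have := polybdD polybdm_z (polybdm_cst k%:R); congr polybd.
by apply/funext => w; rewrite /marginal natrD.
Qed.

Lemma polybdm_zS : bd (fun z _ => z.+1%:R).
Proof.
have := polybdm_zD 1; congr polybd.
by apply/funext => w; rewrite /marginal addn1.
Qed.

Lemma polybdm_inv (f : nat -> nat -> nat) : bd (fun z y => (f z y)%:R^-1).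
Proof. exact: polybd_inv. Qed.

Lemma polybdmD F G : bd F -> bd G -> bd (fun z y => F z y + G z y).
Proof. exact: polybdD. Qed.

Lemma polybdmN F : bd F -> bd (fun z y => - F z y).
Proof. exact: polybdN. Qed.

Lemma polybdmM F G : bd F -> bd G -> bd (fun z y => F z y * G z y).
Proof. exact: polybdM. Qed.

Lemma polybdmX F n : bd F -> bd (fun z y => F z y ^+ n).
Proof. exact: polybdX. Qed.

End marginal_polybd.

(** The coefficients below are built from [z], [y], constants and reciprocals of naturals by sums,
    opposites, products and powers, so their growth bounds follow by structural descent. *)
Ltac bounded := repeat (
  solve [assumption | apply: polybdm_cst | apply: polybdm_z | apply: polybdm_y
        | apply: polybdm_zS | apply: polybdm_zD | apply: polybdm_inv]
  || apply: polybdmD || apply: polybdmN || apply: polybdmM || apply: polybdmX).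

(** * Shift identities for X_. and Y, and the risk formula *)

Section risk.
Context (R : realType) (m : nat) d (T : measurableType d).
Context (P : 'rV[R]_m -> probability T R).
Context (X : 'I_m -> {mfun T >-> nat}) (Y : {mfun T >-> nat}).
Hypothesis hmodel : poisson_model P X Y.
Variable lam : 'rV[R]_m.
Hypothesis lam0 : positive_row lam.
Hypothesis m0 : (0 < m)%N.

Local Notation L := (\sum_i lam 0 i).
Local Notation M G := (mean (P lam) (joint_family X Y) (@marginal R m G)).
Local Notation bd G := (polybd (@marginal R m G)).
Implicit Types F G : nat -> nat -> R.

Let mu (o : option 'I_m) : R := if o is Some i then lam 0 i else L.

Lemma sum_lam_gt0 : 0 < L.
Proof.
rewrite (bigD1 (Ordinal m0))//= ltr_pwDl ?lam0// sumr_ge0// => i _.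
exact/ltW/lam0.
Qed.

Let mu0 o : 0 < mu o.
Proof. by case: o => [i|]; [exact: lam0|exact: sum_lam_gt0]. Qed.

Let ind : mutually_independent (P lam) (joint_family X Y).
Proof. by have [] := hmodel lam0. Qed.

Let law o : has_poisson_law (P lam) (joint_family X Y o) (mu o).
Proof. by have [_ hX hY] := hmodel lam0; case: o => [i|]; [exact: hX|exact: hY]. Qed.

Lemma mean_marginalD F G : bd F -> bd G -> M (fun z y => F z y + G z y) = M F + M G.
Proof. exact: (meanD mu0 ind law). Qed.

Lemma mean_marginalZ (c : R) F : bd F -> M (fun z y => c * F z y) = c * M F.
Proof. exact: (meanZ mu0 ind law). Qed.

Lemma mean_marginal_gt0 F : bd F -> (forall z y, 0 < F z y) -> 0 < M F.
Proof. by move=> bF F0; apply: (mean_gt0 mu0 ind law) => // w; exact: F0. Qed.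

Lemma mean_shift_Y F : bd F ->
  M (fun z y => y%:R * F z y) = L * M (fun z y => F z y.+1).
Proof.
move=> bF; rewrite (mean_shift mu0 ind law None bF); congr (_ * mean _ _ _).
by apply/funext => w; rewrite /marginal sumX_incr_None ffunE eqxx addn1.
Qed.

Lemma mean_shift_X F i : bd F ->
  mean (P lam) (joint_family X Y) (fun w => (w (Some i))%:R * marginal F w) =
  lam 0 i * M (fun z y => F z.+1 y).
Proof.
move=> bF; rewrite (mean_shift mu0 ind law (Some i) bF); congr (_ * mean _ _ _).
by apply/funext => w; rewrite /marginal sumX_incr ffunE addn0.
Qed.

(** The shifts in the single X_i add up: for functions of (X_., Y), X_. obeys the identity of a
    Poisson variable of mean [L]. *)
Lemma mean_shift_sumX F : bd F ->
  M (fun z y => z%:R * F z y) = L * M (fun z y => F z.+1 y).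
Proof.
move=> bF; rewrite mulr_suml -(eq_bigr _ (fun i _ => mean_shift_X i bF)).
rewrite -(mean_sum mu0 ind law) => [|i].
  by congr mean; apply/funext => w; rewrite -mulr_suml -natr_sum.
by apply: polybdM => //; exact: polybd_coord.
Qed.

(** Expanding the square gives the i-th loss term G^2 w_i^2 / lam_i - 2 G w_i + lam_i. Shifting one
    factor w_i in the first term yields lam_i, which cancels the denominator, and leaves (w_i + 1)
    G^2 with G taken at X_. + 1; the second term is shifted likewise. *)
Lemma risk_radial (delta : estimator R m) G :
  (forall (x : 'rV[nat]_m) y i, delta x y 0 i = G (\sum_j x ord0 j)%N y * (x 0 i)%:R) ->
  bd G -> bd (fun z y => G z.+1 y) ->
  risk P X Y delta lam =
  (M (fun z y => (z + m)%:R * G z.+1 y ^+ 2) - 2 * L * M (fun z y => G z.+1 y) + L)%:E.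
Proof.
move=> deltaE bG bG1.
pose c i : {ffun option 'I_m -> nat} -> R := fun w => (w (Some i))%:R.
pose G2 := fun z y => G z y ^+ 2.
have bG2 : bd G2 by exact: polybdmX.
have bc i : polybd (c i) by exact: polybd_coord.
pose h i w := (lam 0 i)^-1 * (c i w * (c i w * marginal G2 w)) +
  (- 2 * (c i w * marginal G w) + lam 0 i).
have bcG2 i : polybd (fun w => c i w * marginal G2 w) by exact: polybdM.
have bccG2 i : polybd (fun w => c i w * (c i w * marginal G2 w)) by exact: polybdM.
have bcG i : polybd (fun w => c i w * marginal G w) by exact: polybdM.
have bcl (r : R) : polybd (fun _ : {ffun option 'I_m -> nat} => r) by exact: polybd_cst.
have b1 i : polybd (fun w => (lam 0 i)^-1 * (c i w * (c i w * marginal G2 w))).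
  exact: polybdM.
have b2 i : polybd (fun w => - 2 * (c i w * marginal G w)) by exact: polybdM.
have b3 i : polybd (fun w => - 2 * (c i w * marginal G w) + lam 0 i) by exact: polybdD.
have bh i : polybd (h i) by exact: polybdD.
have lossE t : loss (delta (\row_i X i t) (Y t)) lam =
    \sum_i h i (tuple_of (joint_family X Y) t).
  apply: eq_bigr => i _; rewrite deltaE /h /c /marginal /G2 /sumX !ffunE !mxE.
  under eq_bigr do rewrite mxE.
  under [in RHS]eq_bigr do rewrite ffunE.
  by have := lam0 i => li; field; rewrite gt_eqF.
rewrite /risk; under eq_fun do rewrite lossE.
rewrite (expectation_mean mu0 ind law (F := fun w => \sum_i h i w));
  last exact: polybd_sum.
congr EFin; rewrite (mean_sum mu0 ind law)//.
have hE i : mean (P lam) (joint_family X Y) (h i) =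
    mean (P lam) (joint_family X Y)
      (fun w => (c i w + 1) * marginal (fun z y => G z.+1 y ^+ 2) w)
    - 2 * (lam 0 i * M (fun z y => G z.+1 y)) + lam 0 i.
  rewrite /h (meanD mu0 ind law (b1 i) (b3 i)) (meanD mu0 ind law (b2 i) (bcl _)).
  rewrite (meanZ mu0 ind law _ (bccG2 i)) (meanZ mu0 ind law _ (bcG i)).
  rewrite (mean_shift mu0 ind law (Some i) (bcG2 i)) mean_shift_X//.
  rewrite mulrA mulVf ?gt_eqF ?lam0//.
  rewrite mul1r mulNr addrA; congr (_ - _ + _).
    congr mean; apply/funext => w.
    by rewrite /marginal /c /G2 sumX_incr !ffunE eqxx addn0 natrD.
  by rewrite /mean Rintegral_cst// [X in fine X](probability_setT (P lam)) mulr1.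
rewrite (eq_bigr _ (fun i _ => hE i)) !big_split/= sumrN -mulr_sumr -mulr_suml mulrA.
congr (_ - _ + _); rewrite -(mean_sum mu0 ind law); last first.
  by move=> i; apply: polybdM; [exact: polybdD|exact: polybdmX].
congr mean; apply/funext => w.
(* Summing [c i w + 1] over the m coordinates gives X_. + m. *)
rewrite -mulr_suml big_split/= -natr_sum sumr_const card_ord.
by rewrite /marginal natrD.
Qed.

End risk.

(** * The two risk comparisons, with m = n + 1 *)

Section comparison.
Context (R : realType) (n : nat) d (T : measurableType d).
Context (P : 'rV[R]_n.+1 -> probability T R).
Context (X : 'I_n.+1 -> {mfun T >-> nat}) (Y : {mfun T >-> nat}).
Hypothesis hmodel : poisson_model P X Y.
Hypothesis n0 : (0 < n)%N.
Variable lam : 'rV[R]_n.+1.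
Hypothesis lam0 : positive_row lam.

Local Notation L := (\sum_i lam 0 i).
Local Notation M G := (mean (P lam) (joint_family X Y) (@marginal R n.+1 G)).

(** Coefficients of x in the three estimators, with m - 1 written as [n]. The denominators are casts
    of naturals, the form that [polybdm_inv] accepts. *)
Let gML z y : R := (z%:R + y%:R) / 2 * z%:R^-1.
Let gO z y : R := (z%:R + y%:R + n%:R) / 2 * (z + n)%:R^-1.
Let gH z y : R := (z%:R + y%:R) / 2 * (z + n)%:R^-1.

Let row_totalE (x : 'rV[nat]_n.+1) : row_total R x = (\sum_j x ord0 j)%:R.
Proof. by rewrite /row_total natr_sum. Qed.

Let lam_ML_E (x : 'rV[nat]_n.+1) y i :
  lam_ML R x y 0 i = gML (\sum_j x ord0 j)%N y * (x 0 i)%:R.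
Proof. by rewrite /gML -row_totalE !mxE; ring. Qed.

Let lam_O_E (x : 'rV[nat]_n.+1) y i :
  lam_O R x y 0 i = gO (\sum_j x ord0 j)%N y * (x 0 i)%:R.
Proof. by rewrite /gO natrD -row_totalE !mxE -(natr1 n) !addrA !addrK; ring. Qed.

Let lam_hat_E (x : 'rV[nat]_n.+1) y i :
  lam_hat R x y 0 i = gH (\sum_j x ord0 j)%N y * (x 0 i)%:R.
Proof. by rewrite /gH natrD -row_totalE !mxE -(natr1 n) !addrA !addrK; ring. Qed.

Let n_gt0 : 0 < n%:R :> R.
Proof. by rewrite ltr0n. Qed.

Let S_gt0 (z : nat) : 0 < 1 + z%:R :> R.
Proof. by rewrite nat1r. Qed.

(** The risk of ML minus that of O equals L E[u0 + X_. q(X_.)], and this integrand is positive at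
    every value of X_.. *)
Lemma risk_O_lt_ML :
  (risk P X Y (@lam_O R n.+1) lam < risk P X Y (@lam_ML R n.+1) lam)%E.
Proof.
rewrite (risk_radial hmodel lam0 isT lam_O_E)//; try by rewrite /gO; bounded.
rewrite (risk_radial hmodel lam0 isT lam_ML_E)//; try by rewrite /gML; bounded.
rewrite lte_fin ltrD2r.
pose r z : R := z.+1%:R^-1; pose t z : R := (z.+1 + n)%:R^-1.
(* At z + 1, [gML - gO] is y v, and the difference of the squares times z + 1 + n is y U. Shifting Y
   calls for U at y + 1, which is u0 + y u1; the remaining factor y is removed by a second shift. *)
pose U z y : R := n%:R / 2 * r z * (1 + y%:R / 2 * (r z + t z)).
pose u0 z (y : nat) : R := n%:R / 2 * r z * (1 + 2^-1 * (r z + t z)).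
pose u1 z (y : nat) : R := n%:R / 4 * r z * (r z + t z).
pose v z (y : nat) : R := n%:R / 2 * r z * t z.
(* Chosen so that [q z.+1] is u1 - 2 v; the shift in X_. then absorbs the remaining factor [L]. *)
pose q z (y : nat) : R :=
  n%:R / 4 * (z%:R^-1 * z%:R^-1 - 3 * (z%:R^-1 * (z + n)%:R^-1)).
pose aO z y : R := (z + n.+1)%:R * gO z.+1 y ^+ 2.
have bU : polybd (@marginal R n.+1 U) by rewrite /U /r /t; bounded.
have bu0 : polybd (@marginal R n.+1 u0) by rewrite /u0 /r /t; bounded.
have bu1 : polybd (@marginal R n.+1 u1) by rewrite /u1 /r /t; bounded.
have bv : polybd (@marginal R n.+1 v) by rewrite /v /r /t; bounded.
have bq : polybd (@marginal R n.+1 q) by rewrite /q; bounded.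
have bqS : polybd (@marginal R n.+1 (fun z => q z.+1)) by rewrite /q; bounded.
have baO : polybd (@marginal R n.+1 aO) by rewrite /aO /gO; bounded.
have bgO : polybd (@marginal R n.+1 (fun z y => gO z.+1 y)) by rewrite /gO; bounded.
have E1 : M (fun z y => (z + n.+1)%:R * gML z.+1 y ^+ 2) = M aO + L * (M u0 + L * M u1).
  have -> : M u0 + L * M u1 = M (fun z y => U z y.+1).
    rewrite -(mean_shift_Y hmodel lam0 isT bu1)//.
    rewrite -(mean_marginalD hmodel lam0 isT)//; last by bounded.
    congr mean; apply/funext => w; rewrite /marginal /u0 /u1 /U -(natr1 (w None)).
    by field.
  rewrite -(mean_shift_Y hmodel lam0 isT bU)//.
  rewrite -(mean_marginalD hmodel lam0 isT)//; last by bounded.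
  congr mean; apply/funext => w; rewrite /marginal /U /aO /gML /gO /r /t.
  rewrite addnS -addSn !natrD -nat1r; have := S_gt0 (sumX w) => z0; field.
  by rewrite !gt_eqF// ltr_pwDl.
have E2 : M (fun z y => gML z.+1 y) = M (fun z y => gO z.+1 y) + L * M v.
  rewrite -(mean_shift_Y hmodel lam0 isT bv)//.
  rewrite -(mean_marginalD hmodel lam0 isT)//; last by bounded.
  congr mean; apply/funext => w; rewrite /marginal /v /gML /gO /r /t.
  rewrite natrD -nat1r; have := S_gt0 (sumX w) => z0; field.
  by rewrite !gt_eqF// ltr_pwDl.
have E3 : L * M u1 = M (fun z y => z%:R * q z y) + 2 * L * M v.
  rewrite (mean_shift_sumX hmodel lam0 isT bq) -mulrA mulrCA -mulrDr; congr (_ * _).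
  rewrite -(mean_marginalZ hmodel lam0 isT)//.
  rewrite -(mean_marginalD hmodel lam0 isT)//; last by bounded.
  congr mean; apply/funext => w; rewrite /marginal /v /u1 /q.
  by rewrite -/(r (sumX w)) -/(t (sumX w)); field.
have : 0 < L * M (fun z y => u0 z y + z%:R * q z y).
  rewrite mulr_gt0 ?sum_lam_gt0//.
  apply: (mean_marginal_gt0 hmodel lam0 isT) => //; first by bounded.
  move=> z y; rewrite /u0 /q.
  have r0 : 0 < r z by rewrite invr_gt0 ltr0n.
  have t0 : 0 < t z by rewrite invr_gt0 ltr0n.
  (* At z = 0 the term z q vanishes and u0 is positive. For z = k + 1 the factor z cancels one
     reciprocal, so that z q is n/4 (a - 3 b). *)
  case: z => [|k] in r0 t0 *.
    by rewrite mul0r addr0 !mulr_gt0// ?addr_gt0// ?mulr_gt0// ?addr_gt0.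
  set a : R := k.+1%:R^-1; set b : R := (k.+1 + n)%:R^-1.
  have ra : r k.+1 <= a by rewrite lef_pV2 ?posrE ?ltr0n// ler_nat.
  (* Here n >= 1, that is m >= 2, is essential: k + 2 <= k + 1 + n. *)
  have br : b <= r k.+1 by rewrite lef_pV2 ?posrE ?ltr0n// ler_nat; lia.
  have ka : k.+1%:R * a = 1 by rewrite mulfV.
  have -> : k.+1%:R * (n%:R / 4 * (a * a - 3 * (a * b))) =
    n%:R / 4 * (k.+1%:R * a * (a - 3 * b)) by ring.
  rewrite ka (mul1r (a - _)).
  have -> : n%:R / 2 * r k.+1 * (1 + 2^-1 * (r k.+1 + t k.+1)) +
      n%:R / 4 * (a - 3 * b) =
    n%:R / 4 * (2 * r k.+1 + r k.+1 * (r k.+1 + t k.+1) + (a - 3 * b)) by field.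
  rewrite mulr_gt0 ?divr_gt0//.
  (* Since b <= r <= a, the linear part 2 r + a - 3 b is nonnegative; strictness comes from this
     product. *)
  have : 0 < r k.+1 * (r k.+1 + t k.+1) by rewrite mulr_gt0// addr_gt0.
  lra.
rewrite (mean_marginalD hmodel lam0 isT)//; last by bounded.
rewrite E1 E2 E3 -/aO; lra.
Qed.

(** Here the difference of the risks is E[u - (n/2) X_. q(X_.)], again with a positive integrand. *)
Lemma risk_hat_lt_O :
  (risk P X Y (@lam_hat R n.+1) lam < risk P X Y (@lam_O R n.+1) lam)%E.
Proof.
rewrite (risk_radial hmodel lam0 isT lam_O_E)//; try by rewrite /gO; bounded.
rewrite (risk_radial hmodel lam0 isT lam_hat_E)//; try by rewrite /gH; bounded.
rewrite lte_fin ltrD2r.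
(* At z + 1, [gO - gH] is (n/2) t, and the difference of the squares times z + 1 + n is u + (n/2) y
   t. As [q z.+1] is [t z], the shift in X_. turns L E[t] into E[X_. q]. *)
pose t z (y : nat) : R := (z.+1 + n)%:R^-1.
pose q z (y : nat) : R := (z + n)%:R^-1.
pose u z (y : nat) : R := n%:R / 4 * ((2 * z.+1%:R + n%:R) * t z y).
pose aH z y : R := (z + n.+1)%:R * gH z.+1 y ^+ 2.
have bt : polybd (@marginal R n.+1 t) by rewrite /t; bounded.
have bq : polybd (@marginal R n.+1 q) by rewrite /q; bounded.
have bu : polybd (@marginal R n.+1 u) by rewrite /u /t; bounded.
have baH : polybd (@marginal R n.+1 aH) by rewrite /aH /gH; bounded.
have bgH : polybd (@marginal R n.+1 (fun z y => gH z.+1 y)) by rewrite /gH; bounded.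
have E1 : M (fun z y => (z + n.+1)%:R * gO z.+1 y ^+ 2) =
    M aH + (M u + n%:R / 2 * (L * M t)).
  rewrite -(mean_shift_Y hmodel lam0 isT bt)//.
  rewrite -(mean_marginalZ hmodel lam0 isT)//; last by bounded.
  rewrite -(mean_marginalD hmodel lam0 isT)//; last by bounded.
  rewrite -(mean_marginalD hmodel lam0 isT)//; last by bounded.
  congr mean; apply/funext => w; rewrite /marginal /u /t /aH /gH /gO.
  rewrite addnS -addSn !natrD -nat1r; have := S_gt0 (sumX w) => z0; field.
  by rewrite !gt_eqF// ltr_pwDl.
have E2 : M (fun z y => gO z.+1 y) = M (fun z y => gH z.+1 y) + n%:R / 2 * M t.
  rewrite -(mean_marginalZ hmodel lam0 isT)//.
  rewrite -(mean_marginalD hmodel lam0 isT)//; last by bounded.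
  congr mean; apply/funext => w; rewrite /marginal /t /gH /gO.
  rewrite natrD -nat1r; have := S_gt0 (sumX w) => z0; field.
  by rewrite !gt_eqF// ltr_pwDl.
have E3 : L * M t = M (fun z y => z%:R * q z y).
  by rewrite (mean_shift_sumX hmodel lam0 isT bq).
have : 0 < M (fun z y => u z y + (- (n%:R / 2)) * (z%:R * q z y)).
  apply: (mean_marginal_gt0 hmodel lam0 isT) => //; first by bounded.
  move=> z y; rewrite /u /q /t.
  have zn : 0 < z%:R + n%:R :> R by rewrite ltr_wpDl.
  (* Over the common denominator the terms quadratic in z cancel, leaving the numerator n (z + n +
     2). *)
  have -> : n%:R / 4 * ((2 * z.+1%:R + n%:R) * (z.+1 + n)%:R^-1) +
      - (n%:R / 2) * (z%:R * (z + n)%:R^-1) =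
    n%:R / 4 * (n%:R * (z%:R + n%:R + 2) / ((1 + z%:R + n%:R) * (z%:R + n%:R))) :> R.
    rewrite !natrD -nat1r; have := S_gt0 z => z0; field.
    by rewrite !gt_eqF// ltr_pwDl.
  rewrite mulr_gt0 ?divr_gt0//; first by rewrite mulr_gt0// addr_gt0.
  by rewrite mulr_gt0// ltr_pwDl.
rewrite (mean_marginalD hmodel lam0 isT)//; try by bounded.
rewrite (mean_marginalZ hmodel lam0 isT (- (n%:R / 2)))//; last by bounded.
rewrite E1 E2 -E3 -/aH; lra.
Qed.

End comparison.

Theorem theorem2p1 (R : realType) (m : nat) (hm : (2 <= m)%N)
    (d : measure_display) (T : measurableType d)
    (P : 'rV[R]_m -> probability T R)
    (X : 'I_m -> {mfun T >-> nat}) (Y : {mfun T >-> nat})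
    (hmodel : poisson_model P X Y) :
  risk_dominated_by P X Y (@lam_ML R m) (@lam_O R m) /\
  risk_dominated_by P X Y (@lam_O R m) (@lam_hat R m).
Proof.
case: m hm P X hmodel => [//|n] n0 P X hmodel.
(* Any positive vector witnesses strictness; the all-ones vector is taken. *)
have one0 : positive_row (const_mx 1 : 'rV[R]_n.+1) by move=> i; rewrite mxE.
split; split.
- by move=> lam lam0; exact/ltW/risk_O_lt_ML.
- by exists (const_mx 1) => //; exact: risk_O_lt_ML.
- by move=> lam lam0; exact/ltW/risk_hat_lt_O.
- by exists (const_mx 1) => //; exact: risk_hat_lt_O.
Qed.
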